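(* Let $\mathbf{B}_1\in\mathbb{H}^{r\times s}_{r_1}$, $\mathbf{A}_2\in\mathbb{H}^{m\times p}_{r_2}$, $\mathbf{C}\in\mathbb{H}^{m\times s}$, and let $\mathbf{X}_1=\mathbf{C}\mathbf{B}_1^\dagger=(x^{(1)}_{ij})\in\mathbb{H}^{m\times r}$ and $\mathbf{X}_2=\mathbf{A}_2^\dagger\mathbf{C}-\mathbf{A}_2^\dagger\mathbf{C}\mathbf{P}_{B_1}=(x^{(2)}_{gf})\in\mathbb{H}^{p\times s}$. Let $\mathbf{c}^{(1)}_{i.}$ be the $i$th row of $\mathbf{C}_1=\mathbf{C}\mathbf{B}_1^*$, $\mathbf{c}^{(2)}_{.f}$ the $f$th column of $\mathbf{C}_2=\mathbf{A}_2^*\mathbf{C}$, and $\dot{\mathbf{b}}^{(1)}_{.f}$ the $f$th column of $\mathbf{B}_1^*\mathbf{B}_1$. Then $$x^{(1)}_{ij}=\frac{\sum_{\alpha\in I_{r_1,r}\{j\}}\mathrm{rdet}_j\big((\mathbf{B}_1\mathbf{B}_1^* )_{j.}(\mathbf{c}^{(1)}_{i.})\big)^\alpha_\alpha}{\sum_{\alpha\in I_{r_1,r}}|\mathbf{B}_1\mathbf{B}_1^*|^\alpha_\alpha},$$ $$x^{(2)}_{gf}=\frac{\sum_{\beta\in J_{r_2,p}\{g\}}\mathrm{cdet}_g\big((\mathbf{A}_2^*\mathbf{A}_2)_{.g}(\mathbf{c}^{(2)}_{.f})\big)^\beta_\beta}{\sum_{\beta\in J_{r_2,p}}|\mathbf{A}_2^*\mathbf{A}_2|^\beta_\beta}-\frac{\sum_{l=1}^s\sum_{\beta\in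 J_{r_2,p}\{g\}}\mathrm{cdet}_g\big((\mathbf{A}_2^*\mathbf{A}_2)_{.g}(\mathbf{c}^{(2)}_{.l})\big)^\beta_\beta\sum_{\beta\in J_{r_1,s}\{l\}}\mathrm{cdet}_l\big((\mathbf{B}_1^*\mathbf{B}_1)_{.l}(\dot{\mathbf{b}}^{(1)}_{.f})\big)^\beta_\beta}{\sum_{\beta\in J_{r_2,p}}|\mathbf{A}_2^*\mathbf{A}_2|^\beta_\beta\sum_{\beta\in J_{r_1,s}}|\mathbf{B}_1^*\mathbf{B}_1|^\beta_\beta}.$$
   Context: $\mathbb{H}$ is the skew field of real quaternions; $\mathbb{H}^{m\times n}$ is the set of $m\times n$ matrices over $\mathbb{H}$ and $\mathbb{H}^{m\times n}_r$ the subset of those of rank $r$. $\mathbf{A}^*$ is the conjugate transpose and $\mathbf{A}^\dagger$ the Moore–Penrose inverse (the unique $\mathbf{X}$ with $\mathbf{AXA}=\mathbf{A}$, $\mathbf{XAX}=\mathbf{X}$, $(\mathbf{AX})^*=\mathbf{AX}$, $(\mathbf{XA})^*=\mathbf{XA}$). $\mathbf{P}_A=\mathbf{A}^\dagger\mathbf{A}$. For a matrix $\mathbf{F}$, $\mathbf{F}_{.j}(\mathbf{b})$ (resp. $\mathbf{F}_{i.}(\mathbf{b})$) is $\mathbf{F}$ with its $j$th column (resp. $i$th row) replaced by the column (resp. row) $\mathbf{b}$. Row/column determinants: for $\mathbf{F}=(a_{ij})\in\mathbb{H}^{n\times n}$, $\mathrm{rdet}_i\mathbf{F}=\sum_{\sigma\in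 S_n}(-1)^{n-r}(a_{i\,i_{k_1}}a_{i_{k_1}i_{k_1+1}}\cdots a_{i_{k_1+l_1}i})\cdots(a_{i_{k_r}i_{k_r+1}}\cdots a_{i_{k_r+l_r}i_{k_r}})$, where $\sigma=(i\,i_{k_1}\,i_{k_1+1}\cdots i_{k_1+l_1})(i_{k_2}\cdots i_{k_2+l_2})\cdots(i_{k_r}\cdots i_{k_r+l_r})$ is the decomposition of $\sigma$ into $r$ disjoint cycles (fixed points included) with $i_{k_2}<\cdots<i_{k_r}$ and $i_{k_t}<i_{k_t+s}$ for $t=2,\dots,r$, $s=1,\dots,l_t$; and $\mathrm{cdet}_j\mathbf{F}=\sum_{\tau\in S_n}(-1)^{n-r}(a_{j_{k_r}j_{k_r+l_r}}\cdots a_{j_{k_r+1}j_{k_r}})\cdots(a_{j\,j_{k_1+l_1}}\cdots a_{j_{k_1+1}j_{k_1}}a_{j_{k_1}j})$, where $\tau=(j_{k_r+l_r}\cdots j_{k_r+1}\,j_{k_r})\cdots(j_{k_2+l_2}\cdots j_{k_2})(j_{k_1+l_1}\cdots j_{k_1+1}\,j_{k_1}\,j)$ is the decomposition into $r$ disjoint cycles with $j_{k_2}<\cdots<j_{k_r}$ and $j_{k_t}<j_{k_t+s}$ for $t=2,\dots,r$, $s=1,\dots,l_t$. For Hermitian $\mathbf{F}$ all these coincide and are real; this value is $\det\mathbf{F}$. Index sets: $L_{k,n}$ is the set of strictly increasing sequences $\alpha=(\alpha_1<\cdots<\alpha_k)$ in $\{1,\dots,n\}$; $I_{k,m}\{i\}=\{\alpha\in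 L_{k,m}: i\in\alpha\}$, $J_{k,n}\{j\}=\{\beta\in L_{k,n}: j\in\beta\}$; sums over $J_{k,n}$ or $I_{k,m}$ without braces run over all of $L_{k,n}$, $L_{k,m}$. For a square $\mathbf{F}$, $\mathbf{F}^\alpha_\alpha$ is the principal submatrix with rows and columns indexed by $\alpha$; $\mathrm{cdet}_i(\mathbf{G})^\beta_\beta$ (resp. $\mathrm{rdet}_j(\mathbf{G})^\alpha_\alpha$) is the column (resp. row) determinant of the principal submatrix $\mathbf{G}^\beta_\beta$ taken at the column (resp. row) coming from index $i$ (resp. $j$); for Hermitian $\mathbf{F}$, $|\mathbf{F}|^\alpha_\alpha=\det\mathbf{F}^\alpha_\alpha$. *)

(* Defs.v *)
From HB Require Import structures.
From mathcomp Require Import all_boot all_order all_algebra all_fingroup.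
From mathcomp Require Import ring.
From mathcomp Require Import reals.
Set Implicit Arguments. Unset Strict Implicit. Unset Printing Implicit Defensive.
Import Order.TTheory GRing.Theory Num.Theory.
Local Open Scope ring_scope.

(* q = q0 + q1 i + q2 j + q3 k, stored as a row vector of length 4.   *)
Definition quat (R : comNzRingType) := 'rV[R]_4.
HB.instance Definition _ (R : comNzRingType) := GRing.Zmodule.on (quat R).

Section Quat.
Variable R : comNzRingType.
Local Notation H := (quat R).

Definition qc (q : H) (k : nat) : R := q ord0 (inord k).
Definition mkq (a b c d : R) : H := \row_(k < 4) nth 0 [:: a; b; c; d] k.

Definition qone : H := mkq 1 0 0 0.
Definition qmul (p q : H) : H :=
  mkq (qc p 0 * qc q 0 - qc p 1 * qc q 1 - qc p 2 * qc q 2 - qc p 3 * qc q 3)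
      (qc p 0 * qc q 1 + qc p 1 * qc q 0 + qc p 2 * qc q 3 - qc p 3 * qc q 2)
      (qc p 0 * qc q 2 - qc p 1 * qc q 3 + qc p 2 * qc q 0 + qc p 3 * qc q 1)
      (qc p 0 * qc q 3 + qc p 1 * qc q 2 - qc p 2 * qc q 1 + qc p 3 * qc q 0).
Definition qconj (q : H) : H := mkq (qc q 0) (- qc q 1) (- qc q 2) (- qc q 3).

Lemma qc_mk0 a b c d : qc (mkq a b c d) 0 = a.
Proof. by rewrite /qc /mkq mxE inordK. Qed.
Lemma qc_mk1 a b c d : qc (mkq a b c d) 1 = b.
Proof. by rewrite /qc /mkq mxE inordK. Qed.
Lemma qc_mk2 a b c d : qc (mkq a b c d) 2 = c.
Proof. by rewrite /qc /mkq mxE inordK. Qed.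
Lemma qc_mk3 a b c d : qc (mkq a b c d) 3 = d.
Proof. by rewrite /qc /mkq mxE inordK. Qed.

Lemma quat_ext (p q : H) :
  qc p 0 = qc q 0 -> qc p 1 = qc q 1 -> qc p 2 = qc q 2 -> qc p 3 = qc q 3 ->
  p = q.
Proof.
rewrite /qc => h0 h1 h2 h3; apply/rowP => k.
have E : forall (j : 'I_4), j = inord (val j) by move=> j; apply/val_inj; rewrite /= inordK.
rewrite (E k); case: k => [[|[|[|[|k]]]] Hk] //=.
Qed.

Lemma qcD (p q : H) k : qc (p + q) k = qc p k + qc q k.
Proof. by rewrite /qc mxE. Qed.
Lemma qc0 k : qc (0 : H) k = 0.
Proof. by rewrite /qc mxE. Qed.

Local Ltac qsolve := apply: quat_ext;
  rewrite /qmul /qone ?qcD ?qc_mk0 ?qc_mk1 ?qc_mk2 ?qc_mk3 ?qcD ?qc0; ring.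

Lemma qmulA : associative qmul. Proof. by move=> *; qsolve. Qed.
Lemma qmul1 : left_id qone qmul. Proof. by move=> *; qsolve. Qed.
Lemma qmulr1 : right_id qone qmul. Proof. by move=> *; qsolve. Qed.
Lemma qmulDl : left_distributive qmul +%R. Proof. by move=> *; qsolve. Qed.
Lemma qmulDr : right_distributive qmul +%R. Proof. by move=> *; qsolve. Qed.
Lemma qone_neq0 : qone != 0.
Proof.
apply/eqP => /(congr1 (fun q => qc q 0)); rewrite qc_mk0 qc0.
by move/eqP; rewrite oner_eq0.
Qed.
End Quat.

HB.instance Definition _ (R : comNzRingType) :=
  GRing.Zmodule_isNzRing.Build (quat R) (@qmulA R) (@qmul1 R) (@qmulr1 R)
    (@qmulDl R) (@qmulDr R) (@qone_neq0 R).

Definition qnorm2 (R : comNzRingType) (q : quat R) : R :=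
  qc q 0 ^+ 2 + qc q 1 ^+ 2 + qc q 2 ^+ 2 + qc q 3 ^+ 2.
Definition qinv (R : fieldType) (q : quat R) : quat R :=
  let n := (qnorm2 q)^-1 in
  mkq (n * qc q 0) (- (n * qc q 1)) (- (n * qc q 2)) (- (n * qc q 3)).
Definition qdiv (R : fieldType) (a d : quat R) : quat R := a * qinv d.

Section QMatrices.
Variable R : realType.
Local Notation H := (quat R).

Definition qadj m n (A : 'M[H]_(m, n)) : 'M[H]_(n, m) := (map_mx (@qconj R) A)^T.

Definition is_MP m n (A : 'M[H]_(m, n)) (X : 'M[H]_(n, m)) : Prop :=
  [/\ A *m X *m A = A, X *m A *m X = X,
      qadj (A *m X) = A *m X & qadj (X *m A) = X *m A].

Definition cols_indep m n (A : 'M[H]_(m, n)) (S : {set 'I_n}) : Prop :=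
  forall v : 'cV[H]_n, (forall j, j \notin S -> v j 0 = 0) -> A *m v = 0 -> v = 0.

Definition qrank m n (A : 'M[H]_(m, n)) (k : nat) : Prop :=
  (exists2 S : {set 'I_n}, #|S| = k & cols_indep A S) /\
  (forall S : {set 'I_n}, cols_indep A S -> (#|S| <= k)%N).

Definition row_repl m n (i : 'I_m) (b : 'rV[H]_n) (F : 'M[H]_(m, n)) : 'M[H]_(m, n) :=
  \matrix_(a, c) if a == i then b 0 c else F a c.
Definition col_repl m n (j : 'I_n) (b : 'cV[H]_m) (F : 'M[H]_(m, n)) : 'M[H]_(m, n) :=
  \matrix_(a, c) if c == j then b a 0 else F a c.

Definition cycprod n (A : 'M[H]_n) (s : 'S_n) (x : 'I_n) : H :=
  \big[*%R/1]_(k < #|porbit s x|) A ((s ^+ k)%g x) ((s ^+ k.+1)%g x).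

(* the cycles of s not containing i, each represented by its least element,
   listed in increasing order of these least elements *)
Definition leaders n (s : 'S_n) (i : 'I_n) : seq 'I_n :=
  [seq x <- enum 'I_n | (x \notin porbit s i) && [forall y in porbit s x, (x <= y)%N]].

Definition rdet n (i : 'I_n) (A : 'M[H]_n) : H :=
  \sum_(s : 'S_n) (-1) ^+ (n - #|porbits s|) *
     (cycprod A s i * \prod_(x <- leaders s i) cycprod A s x).

Definition cdet n (j : 'I_n) (A : 'M[H]_n) : H :=
  \sum_(s : 'S_n) (-1) ^+ (n - #|porbits s|) *
     ((\prod_(x <- rev (leaders s j)) cycprod A s x) * cycprod A s j).

(* versions taking the distinguished index as a natural number
   (position inside the matrix); the empty matrix gets the value 1 *)
Definition rdet_at k (A : 'M[H]_k) (i : nat) : H :=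
  (match k as k0 return 'M[H]_k0 -> H with
   | 0 => fun _ => 1
   | k'.+1 => fun B => rdet (@inord k' i) B end) A.
Definition cdet_at k (A : 'M[H]_k) (i : nat) : H :=
  (match k as k0 return 'M[H]_k0 -> H with
   | 0 => fun _ => 1
   | k'.+1 => fun B => cdet (@inord k' i) B end) A.

Definition prsub n (F : 'M[H]_n) (S : {set 'I_n}) : 'M[H]_#|S| :=
  \matrix_(a, b) F (enum_val a) (enum_val b).

Definition rdet_pr n (F : 'M[H]_n) (S : {set 'I_n}) (i : 'I_n) : H :=
  rdet_at (prsub F S) (index i (enum S)).
Definition cdet_pr n (F : 'M[H]_n) (S : {set 'I_n}) (j : 'I_n) : H :=
  cdet_at (prsub F S) (index j (enum S)).
(* |F|^S_S for Hermitian F : determinant = rdet_1 of the principal submatrix *)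
Definition hdet_pr n (F : 'M[H]_n) (S : {set 'I_n}) : H :=
  rdet_at (prsub F S) 0.

End QMatrices.

(* Main.v *)
Require Import Defs.
From HB Require Import structures.
From mathcomp Require Import all_boot all_order all_algebra all_fingroup.
From mathcomp Require Import reals.
From mathcomp Require Import ring lra boolp.
Import GRing.Theory.
Local Open Scope ring_scope.
Import Order.TTheory Num.Theory.
Set Implicit Arguments. Unset Strict Implicit. Unset Printing Implicit Defensive.

(* For Hermitian [F] and a set [T] of indices, write [D T] for the principal minor on [T]
   and [L T] for the matrix of left cofactors of the column determinants on [T].  Splitting
   off the last step of the distinguished cycle gives, for [j] in [T],
   [L T i j = [i = j] D (T \ j) - (L (T \ j) F) i j].  By induction on [T] the minors are
   real, hence central, [L T] is Hermitian, the mirror recursion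
   [L T i j = [i = j] D (T \ i) - (F L (T \ i)) i j] holds, and [L T F = D T] on [T].
   Summing over the sets of size [k], with [L_k] and [d_k] the sums of [L T] and [D T],
   yields [L_(k+1) + L_k F = d_k I].
   If [F = A^* A] with [A] of rank [k], then [D T] is positive when the columns of [A] in [T]
   are independent and vanishes otherwise, in which case [L T A^* = 0].  Hence [d_k <> 0],
   [L_(k+1) A^* = 0], and [L_k A^* = L_k F A^+ = d_k A^+], which is the representation of
   [A^+ C] by column determinants.  Conjugate transposition gives the one by row
   determinants; [A] and [A^*] have equal ranks because [rank A = Re tr (A^+ A)]. *)

(** * Real, central and conjugate quaternions *)

Section Quaternions.
Variable R : realType.
Local Notation H := (quat R).
Implicit Types p q d : H.

Lemma qcN q k : qc (- q) k = - qc q k.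
Proof. by rewrite /qc mxE. Qed.

Lemma qc_sum (I : finType) (P : pred I) (G : I -> H) k :
  qc (\sum_(i | P i) G i) k = \sum_(i | P i) qc (G i) k.
Proof. by apply: (big_morph (fun q => qc q k)) => [x y|]; [exact: qcD|exact: qc0]. Qed.

Lemma qmulE p q : p * q = qmul p q.
Proof. by []. Qed.

Lemma qoneE : (1 : H) = qone R.
Proof. by []. Qed.

Local Ltac qsolve := apply: quat_ext;
  rewrite ?qmulE ?qoneE /qmul /qconj /qone ?(qcD, qcN, qc_mk0, qc_mk1, qc_mk2, qc_mk3, qc0); ring.

Lemma qconjD p q : qconj (p + q) = qconj p + qconj q.
Proof. qsolve. Qed.
Lemma qconj0 : qconj (0 : H) = 0.
Proof. qsolve. Qed.
Lemma qconjN p : qconj (- p) = - qconj p.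
Proof. qsolve. Qed.
Lemma qconj1 : qconj (1 : H) = 1.
Proof. qsolve. Qed.
Lemma qconjM p q : qconj (p * q) = qconj q * qconj p.
Proof. qsolve. Qed.
Lemma qconjK : involutive (@qconj R).
Proof. move=> p; qsolve. Qed.

Lemma qconj_sum (I : finType) (P : pred I) (G : I -> H) :
  qconj (\sum_(i | P i) G i) = \sum_(i | P i) qconj (G i).
Proof. by apply: (big_morph _ qconjD); exact: qconj0. Qed.

Lemma qconj_prod (I : Type) (s : seq I) (G : I -> H) :
  qconj (\prod_(i <- s) G i) = \prod_(i <- rev s) qconj (G i).
Proof.
elim: s => [|x s IH]; first by rewrite /rev /= !big_nil qconj1.
by rewrite big_cons qconjM IH rev_cons -cats1 big_cat /= big_cons big_nil mulr1.
Qed.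

Lemma qconj_sign k : qconj ((-1) ^+ k : H) = (-1) ^+ k.
Proof.
elim: k => [|k IH]; first by rewrite expr0 qconj1.
by rewrite exprS qconjM IH qconjN qconj1 -exprSr exprS.
Qed.

Lemma qconj_fixP q : qconj q = q -> [/\ qc q 1 = 0, qc q 2 = 0 & qc q 3 = 0].
Proof.
move=> E.
have E1 := congr1 (fun x => qc x 1) E; have E2 := congr1 (fun x => qc x 2) E.
have E3 := congr1 (fun x => qc x 3) E.
by move: E1 E2 E3; rewrite /qconj qc_mk1 qc_mk2 qc_mk3 => E1 E2 E3; split; lra.
Qed.

Lemma qreal_central d q : qconj d = d -> d * q = q * d.
Proof.
case/qconj_fixP => d1 d2 d3.
by apply: quat_ext; rewrite !qmulE /qmul ?(qc_mk0, qc_mk1, qc_mk2, qc_mk3) d1 d2 d3; ring.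
Qed.

Lemma qc0_realM d q : qconj d = d -> qc (d * q) 0 = qc d 0 * qc q 0.
Proof.
by case/qconj_fixP => d1 d2 d3; rewrite qmulE /qmul qc_mk0 d1 d2 d3; ring.
Qed.

Lemma qreal_eq p q : qconj p = p -> qconj q = q -> qc p 0 = qc q 0 -> p = q.
Proof.
case/qconj_fixP => p1 p2 p3 /qconj_fixP[q1 q2 q3] E.
by apply: quat_ext; rewrite // ?p1 ?p2 ?p3 ?q1 ?q2 ?q3.
Qed.

Lemma qreal_mul_eq0 d q : qconj d = d -> d * q = 0 -> q != 0 -> d = 0.
Proof.
move=> dR E qn0; case/qconj_fixP: (dR) => d1 d2 d3.
apply: qreal_eq => //; first exact: qconj0.
have Ek k : qc (d * q) k = 0 by rewrite E qc0.
move: (Ek 0) (Ek 1) (Ek 2) (Ek 3); rewrite !qmulE /qmul qc_mk0 qc_mk1 qc_mk2 qc_mk3 qc0.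
rewrite d1 d2 d3 => E0 E1 E2 E3.
case: (eqVneq (qc d 0) 0) => // dn0; case/eqP: qn0.
by apply: quat_ext; rewrite qc0; apply: (mulfI dn0); lra.
Qed.

Lemma qmul_realM d q : qconj d = d -> qconj q = q -> qconj (d * q) = d * q.
Proof. by move=> dR qR; rewrite qconjM dR qR (qreal_central _ qR). Qed.

Lemma qmulV d : qconj d = d -> d != 0 -> d * qinv d = 1.
Proof.
move=> dR dn0; case/qconj_fixP: (dR) => d1 d2 d3.
have d0 : qc d 0 != 0.
  apply: contra dn0 => /eqP E; apply/eqP; apply: qreal_eq => //; first exact: qconj0.
  by rewrite qc0.
apply: quat_ext; rewrite qmulE qoneE /qmul /qinv /qone /qnorm2
  ?(qc_mk0, qc_mk1, qc_mk2, qc_mk3) d1 d2 d3; field; rewrite ?expr0n ?addr0 ?sqrf_eq0 //.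
Qed.

(** [qdiv] divides on the right, whereas the denominators below arise as left factors; a real [d] is
    central, so the two agree. *)
Lemma qdiv_real d q x : qconj d = d -> d != 0 -> d * q = x -> q = qdiv x d.
Proof. by move=> dR dn0 <-; rewrite /qdiv (qreal_central _ dR) -mulrA qmulV // mulr1. Qed.

Lemma qconj_div d x : qconj d = d -> d != 0 -> qconj (qdiv x d) = qdiv (qconj x) d.
Proof.
move=> dR dn0; apply: qdiv_real => //.
by rewrite -{1}dR -qconjM /qdiv -mulrA -(qreal_central _ dR) qmulV // mulr1.
Qed.

Lemma qsqr_ge0 q : 0 <= qc (qconj q * q) 0.
Proof.
rewrite qmulE /qmul /qconj ?(qc_mk0, qc_mk1, qc_mk2, qc_mk3).
have := sqr_ge0 (qc q 0); have := sqr_ge0 (qc q 1); have := sqr_ge0 (qc q 2).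
have := sqr_ge0 (qc q 3); rewrite !expr2; lra.
Qed.

Lemma qsqr_eq0 q : qc (qconj q * q) 0 = 0 -> q = 0.
Proof.
rewrite qmulE /qmul /qconj ?(qc_mk0, qc_mk1, qc_mk2, qc_mk3) => E.
have h0 := sqr_ge0 (qc q 0); have h1 := sqr_ge0 (qc q 1); have h2 := sqr_ge0 (qc q 2).
have h3 := sqr_ge0 (qc q 3); rewrite !expr2 in h0 h1 h2 h3.
apply: quat_ext; rewrite qc0; apply/eqP; rewrite -sqrf_eq0 expr2; apply/eqP; lra.
Qed.

(** Makes the real part of the trace of a matrix product cyclic, although quaternions do not
    commute; used in [qrank_adj]. *)
Lemma qc0_mulC p q : qc (p * q) 0 = qc (q * p) 0.
Proof. by rewrite !qmulE /qmul !qc_mk0; ring. Qed.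

Lemma qadjE m n (A : 'M[H]_(m, n)) i j : qadj A i j = qconj (A j i).
Proof. by rewrite /qadj !mxE. Qed.

Lemma qadjM m n k (A : 'M[H]_(m, n)) (B : 'M[H]_(n, k)) :
  qadj (A *m B) = qadj B *m qadj A.
Proof.
apply/matrixP => i j; rewrite qadjE !mxE qconj_sum.
by apply: eq_bigr => l _; rewrite !qadjE qconjM.
Qed.

Lemma qadjK m n (A : 'M[H]_(m, n)) : qadj (qadj A) = A.
Proof. by apply/matrixP => i j; rewrite !qadjE qconjK. Qed.

Lemma qc0_gram m (u : 'cV[H]_m) : 0 <= qc ((qadj u *m u) 0 0) 0.
Proof.
by rewrite mxE qc_sum; apply: sumr_ge0 => i _; rewrite qadjE qsqr_ge0.
Qed.

Lemma gram_col_eq0 m (u : 'cV[H]_m) : qc ((qadj u *m u) 0 0) 0 = 0 -> u = 0.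
Proof.
rewrite mxE qc_sum => /eqP; rewrite psumr_eq0; last by move=> i _; rewrite qadjE qsqr_ge0.
move=> /allP E; apply/colP => i; rewrite mxE.
by apply: qsqr_eq0; move: (E i (mem_index_enum _)); rewrite qadjE => /eqP.
Qed.

(** The diagonal entries of [Y *m qadj Y] are the squared norms of the rows of [Y]. *)
Lemma qadj_mul_eq0 m n (Y : 'M[H]_(m, n)) : Y *m qadj Y = 0 -> Y = 0.
Proof.
move=> E; apply/matrixP => i j; rewrite [RHS]mxE.
have : qadj (row i Y) = 0.
  apply: gram_col_eq0; rewrite qadjK.
  have := congr1 (fun M : 'M_m => M i i) E; rewrite !mxE => Ei.
  suff -> : \sum_k row i Y 0 k * qadj (row i Y) k 0 = 0 by rewrite qc0.
  by rewrite -[RHS]Ei; apply: eq_bigr => k _; rewrite !qadjE !mxE.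
by move/matrixP/(_ j 0); rewrite qadjE !mxE => E'; rewrite -[Y i j]qconjK E' qconj0.
Qed.

End Quaternions.

(** * Column determinants over index subsets *)

Lemma ltn_ord_trans n : transitive (fun x y : 'I_n => (x < y)%N).
Proof. by move=> y x z; apply: ltn_trans. Qed.

Lemma sorted_filter_ord n (P : pred 'I_n) :
  sorted (fun x y : 'I_n => (x < y)%N) [seq x <- enum 'I_n | P x].
Proof.
apply: (sorted_filter (@ltn_ord_trans n)).
have := iota_ltn_sorted 0 n; rewrite -val_enum_ord sorted_map.
by apply: sub_sorted => x y.
Qed.

Section PermutationExpansion.
Variables (R : realType) (n : nat).
Local Notation H := (quat R).
Implicit Types (s t u : 'S_n) (T E : {set 'I_n}) (F : 'M[H]_n).

(* [cycle_leaders (~: T)] lists the cycles of a permutation of [T], and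
   [cycle_leaders (~: T :|: porbit s i)] those not through [i]. *)
Definition cycle_leaders E s : seq 'I_n :=
  [seq x <- enum 'I_n | (x \notin E) && [forall y in porbit s x, (x <= y)%N]].

(** The product over the cycle of [i] without its closing factor [F ((s^-1)%g i) i], which is the
    only factor of the whole term taken from column [i]. *)
Definition cycpath F s i : H :=
  \big[*%R/1]_(k < #|porbit s i|.-1) F ((s ^+ k)%g i) ((s ^+ k.+1)%g i).

Definition cycprods F E s : H := \prod_(x <- rev (cycle_leaders E s)) cycprod F s x.

(** No cycle is distinguished: the cycles are multiplied in decreasing order of their leaders. For
    nonempty [T] this is the column determinant at the least element of [T], see [pdet_min]. *)
Definition pdet F T : H :=
  \sum_(s : 'S_n | perm_on T s) (-1) ^+ s * cycprods F (~: T) s.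

(* [padj F T i j] is the left cofactor of [b j] in the column determinant at [i] of the
   principal submatrix on [T] with column [i] replaced by [b]; see [cdet_pr_repl]. *)
Definition padj F T : 'M[H]_n := \matrix_(i, j)
  \sum_(s : 'S_n | [&& perm_on T s, s j == i & i \in T])
     (-1) ^+ s * (cycprods F (~: T :|: porbit s i) s * cycpath F s i).

Lemma perm_iter_porbit s x : ((s ^+ #|porbit s x|)%g x) = x.
Proof. by rewrite permX iter_porbit. Qed.

Lemma perm_pred_porbit s x : ((s ^+ #|porbit s x|.-1)%g x) = (s^-1)%g x.
Proof.
apply: (@perm_inj _ s); rewrite permKV -permM -expgSr prednK ?perm_iter_porbit //.
by rewrite lt0n card_porbit_neq0.
Qed.

Lemma cycprod_path F s x : cycprod F s x = cycpath F s x * F ((s^-1)%g x) x.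
Proof.
rewrite /cycprod /cycpath -[in RHS](perm_pred_porbit s x).
rewrite -[in X in _ = _ * F _ X](perm_iter_porbit s x).
move: (card_porbit_neq0 s x); case: #|_| => // o _.
by rewrite big_ord_recr.
Qed.

Lemma perm_on_notin T s x y : perm_on T s -> x \in T -> y \in porbit s x -> y \in T.
Proof.
move=> Ts xT /porbitP[k ->]; elim: k => [|k IH]; first by rewrite expg0 perm1.
by rewrite expgSr permM (perm_closed _ Ts).
Qed.

Lemma mem_cycle_leaders E s x :
  (x \in cycle_leaders E s) = (x \notin E) && [forall y in porbit s x, (x <= y)%N].
Proof. by rewrite mem_filter mem_enum andbT. Qed.

Lemma eq_cycle_leaders E E' s s' :
  (forall x, (x \notin E) = (x \notin E')) ->
  (forall x, x \notin E -> porbit s x = porbit s' x) ->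
  cycle_leaders E s = cycle_leaders E' s'.
Proof.
move=> EE' ss'; apply: eq_filter => x; rewrite -EE'.
by case: (boolP (x \notin E)) => //= /ss' ->.
Qed.

Lemma eq_cycprods F E E' s s' :
  (forall x, (x \notin E) = (x \notin E')) ->
  (forall x, x \notin E -> porbit s x = porbit s' x) ->
  (forall x k, x \notin E -> (s ^+ k)%g x = (s' ^+ k)%g x) ->
  cycprods F E s = cycprods F E' s'.
Proof.
move=> EE' ss' sk; rewrite /cycprods (eq_cycle_leaders EE' ss').
apply: eq_big_seq => x; rewrite mem_rev mem_cycle_leaders -EE' => /andP[xE _].
rewrite /cycprod (ss' _ xE); apply: eq_bigr => k _; by rewrite !sk.
Qed.

(** The least element [m] leads its own cycle and precedes every other leader, so in the reversed
    product its cycle comes last, exactly where the distinguished cycle stands. *)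
Lemma pdet_min F T m :
  m \in T -> (forall x, x \in T -> (m <= x)%N) -> pdet F T = (padj F T *m F) m m.
Proof.
move=> mT minm; rewrite mxE.
under eq_bigr => l _ do rewrite mxE mulr_suml.
rewrite (exchange_big_dep (fun s => perm_on T s)) /=; last by move=> l s _ /andP[].
apply: eq_bigr => s Ts.
rewrite (big_pred1 ((s^-1)%g m)) => [|l]; last first.
  by rewrite Ts mT /= andbT (can2_eq (permK s) (permKV s)).
rewrite -!mulrA -cycprod_path; congr (_ * _).
have -> : cycprods F (~: T) s = \prod_(x <- rev (m :: cycle_leaders (~: T :|: porbit s m) s)) cycprod F s x.
  rewrite /cycprods; congr (\prod_(x <- rev _) _).
  (* Two strictly increasing lists with the same members are equal. *)
  apply: (irr_sorted_eq (@ltn_ord_trans n)) => [x||| x]; rewrite ?ltnn //; first exact: sorted_filter_ord.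
    rewrite /= path_min_sorted; first exact: sorted_filter_ord.
    apply/allP => x; rewrite mem_cycle_leaders !inE negb_or negbK => /andP[/andP[xT xm] _].
    rewrite ltn_neqAle minm // andbT; apply: contra xm => /eqP/val_inj ->.
    exact: porbit_id.
  rewrite inE !mem_cycle_leaders !inE negb_or negbK.
  case: (eqVneq x m) => [-> | xm] /=.
    by rewrite mT /=; apply/forall_inP => y /(perm_on_notin Ts mT); apply: minm.
  case: (boolP (x \in T)) => //= xT.
  case: (boolP (x \in porbit s m)) => //= xsm.
  apply/negP => /forall_inP/(_ m); rewrite porbit_sym xsm => /(_ isT) xlem.
  by case/eqP: xm; apply/val_inj/anti_leq; rewrite xlem minm.
rewrite rev_cons -cats1 big_cat /= big_cons big_nil mulr1 //.
Qed.

Lemma pdet0 F : pdet F set0 = 1.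
Proof.
rewrite /pdet (big_pred1 1%g) => [|s].
  rewrite odd_perm1 mul1r /cycprods /cycle_leaders.
  by rewrite (eq_filter (a2 := pred0)) ?filter_pred0 ?big_nil // => x; rewrite !inE.
apply/idP/eqP => [s0|->]; last exact: perm_on1.
by apply: (perm_on_id s0); rewrite cards0.
Qed.

Lemma padj_outl F T i j : i \notin T -> padj F T i j = 0.
Proof. by move=> iT; rewrite mxE big_pred0 // => s; rewrite (negbTE iT) !andbF. Qed.

Lemma padj_outr F T i j : j \notin T -> padj F T i j = 0.
Proof.
move=> jT; rewrite mxE big_pred0 // => s.
by apply/and3P => -[Ts /eqP <-]; rewrite (perm_closed _ Ts) (negbTE jT).
Qed.

(** Multiplying by [tperm i j] inserts the fixed point [j] between [s^-1 i] and [i]; the walk from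
    [i] is unchanged until it would close up. *)
Lemma perm_contract_iter s i j k :
  s j = j -> i != j -> (k < #|porbit s i|)%N ->
  ((s * tperm i j) ^+ k)%g i = (s ^+ k)%g i.
Proof.
move=> sj ij; elim: k => [|k IH] lk; first by rewrite !expg0.
rewrite expgSr !permM IH; last exact: ltnW.
have -> : s ((s ^+ k)%g i) = (s ^+ k.+1)%g i by rewrite expgSr permM.
rewrite tpermD //; last first.
  apply: contraNneq ij => E; have : j \in porbit s i by rewrite E mem_porbit.
  by rewrite porbit_sym => /porbitP[k' ->]; rewrite permX_fix.
apply/eqP => E; have U := uniq_traject_porbit s i.
have o0 : (0 < #|porbit s i|)%N by rewrite lt0n card_porbit_neq0.
have := @nth_uniq _ i (traject s i #|porbit s i|) 0 k.+1.
rewrite size_traject => /(_ o0 lk U); rewrite !nth_traject //.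
by rewrite -(permX s i k.+1) -E /= eqxx.
Qed.

Lemma porbit_contract s i j :
  s j = j -> i != j -> porbit (s * tperm i j)%g i = j |: porbit s i.
Proof.
move=> sj ij; set t := (s * tperm i j)%g.
have o0 : (0 < #|porbit s i|)%N by rewrite lt0n card_porbit_neq0.
have tj : (t ^+ #|porbit s i|)%g i = j.
  rewrite -(prednK o0) expgSr permM perm_contract_iter ?prednK //.
  by rewrite /t permM perm_pred_porbit permKV tpermL.
have ti : t j = i by rewrite /t permM sj tpermR.
apply/setP => x; apply/idP/idP.
  case/porbitP => k ->; elim: k => [|k IH]; first by rewrite expg0 perm1 !inE porbit_id orbT.
  rewrite expgSr permM; case/setU1P: IH => [->|]; first by rewrite ti !inE porbit_id orbT.
  move=> IH; rewrite {1}/t permM !inE.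
  set y := (t ^+ k)%g i in IH *.
  case: tpermP => [| |_ _]; first by rewrite eqxx.
  - by rewrite porbit_id orbT.
  - have -> : s y = (s ^+ 1)%g y by rewrite expg1.
    by rewrite porbit_sym porbit_perm porbit_sym IH orbT.
case/setU1P => [->|]; first by rewrite -tj mem_porbit.
rewrite porbit_traject => /trajectP[k lk ->].
by rewrite -permX -(perm_contract_iter sj ij lk) mem_porbit.
Qed.

Lemma perm_contract_iter_out s i j x k :
  s j = j -> x \notin j |: porbit s i -> ((s * tperm i j) ^+ k)%g x = (s ^+ k)%g x.
Proof.
move=> sj; rewrite !inE negb_or => /andP[xj xi].
elim: k => [|k IH]; first by rewrite !expg0.
rewrite expgSr permM IH permM.
have -> : s ((s ^+ k)%g x) = (s ^+ k.+1)%g x by rewrite expgSr permM.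
rewrite tpermD //.
  by apply: contra xi => /eqP ->; rewrite porbit_sym mem_porbit.
apply: contra xj => /eqP E; have : j \in porbit s x by rewrite E mem_porbit.
by rewrite porbit_sym => /porbitP[k' ->]; rewrite permX_fix.
Qed.

Lemma perm_onS T E s : T \subset E -> perm_on T s -> perm_on E s.
Proof. by move=> TE /subsetP Ts; apply/subsetP => x /Ts; apply: (subsetP TE). Qed.

Lemma perm_onD1 T s j : perm_on T s -> s j = j -> perm_on (T :\ j) s.
Proof.
move=> Ts sj; apply/subsetP => x; rewrite !inE => sx.
rewrite (subsetP Ts x) ?inE // andbT; apply: contra sx => /eqP ->.
by rewrite sj.
Qed.

(* Contracting [j] out of the cycle [i -> ... -> l -> j -> i] writes a permutation with
   [s j = i] as [s' * tperm i j] with [s'] on [T :\ j]; the factor [F l j] stays rightmost,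
   so no commutation is needed. *)
Lemma padj_rec F T i j :
  j \in T -> padj F T i j = (i == j)%:R * pdet F (T :\ j) - (padj F (T :\ j) *m F) i j.
Proof.
move=> jT; case: (eqVneq i j) => [ij|ij]; rewrite ?mul1r ?mul0r ?sub0r; first subst j.
  have -> : (padj F (T :\ i) *m F) i i = 0.
    by rewrite mxE big1 // => l _; rewrite padj_outl ?mul0r // !inE eqxx.
  rewrite subr0 mxE; apply: eq_big => [s | s /and3P[Ts /eqP si iT]].
    apply/and3P/idP => [[Ts /eqP si _]|Ts]; first exact: perm_onD1.
    have si : s i = i by apply: (out_perm Ts); rewrite !inE eqxx.
    by split; rewrite ?si //; apply: perm_onS Ts; apply: subsetDl.
  have oi : porbit s i = [set i].
    apply/setP => x; rewrite inE; apply/porbitP/eqP => [[k ->]|->]; first by rewrite permX_fix.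
    by exists 0; rewrite expg0 perm1.
  rewrite /cycpath oi cards1 big_ord0 mulr1; congr (_ * _); apply: eq_cycprods => // x.
  by rewrite !inE; case: (x == i); case: (x \in T).
case: (boolP (i \in T)) => iT; last first.
  rewrite padj_outl // mxE big1 ?oppr0 // => l _.
  by rewrite padj_outl ?mul0r // !inE (negbTE iT) andbF.
rewrite !mxE -sumrN.
under [RHS]eq_bigr => l _ do rewrite mxE mulr_suml -sumrN.
rewrite (exchange_big_dep (fun s => perm_on (T :\ j) s)) /=; last by move=> l s _ /andP[].
rewrite (reindex_inj (mulIg (tperm i j))) /=.
apply: eq_big => [s | s].
  rewrite permM iT andbT; apply/andP/idP => [[Ts sj]|Ts].
    have sj' : s j = j by apply: (can_inj (tpermK i j)); rewrite tpermR; apply/eqP.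
    apply: perm_onD1 sj'; rewrite -[s](mulgK (tperm i j)) tpermV.
    apply: perm_onM => //; apply: perm_onS (tperm_on _ _).
    by apply/subsetP => x; rewrite !inE => /orP[] /eqP ->.
  have sj : s j = j by apply: (out_perm Ts); rewrite !inE eqxx.
  rewrite sj tpermR eqxx; split => //; apply: perm_onM.
    by apply: perm_onS Ts; apply: subsetDl.
  apply: perm_onS (tperm_on _ _).
  by apply/subsetP => x; rewrite !inE => /orP[] /eqP ->.
case/and3P => Tst; rewrite permM => /eqP stj _.
have sj : s j = j by apply: (can_inj (tpermK i j)); rewrite tpermR.
have Ts : perm_on (T :\ j) s.
  apply: perm_onD1 sj; rewrite -[s](mulgK (tperm i j)) tpermV.
  apply: perm_onM => //; apply: perm_onS (tperm_on _ _).
  by apply/subsetP => x; rewrite !inE => /orP[] /eqP ->.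
rewrite (big_pred1 ((s^-1)%g i)) => [|l]; last first.
  by rewrite /= Ts !inE ij iT !andbT (can2_eq (permK s) (permKV s)).
(* The transposition flips the sign, which yields the minus in front of the product with [F]. *)
rewrite odd_permM odd_tperm ij addbT signrN mulNr; congr (- _).
rewrite -!mulrA; congr (_ * _); rewrite porbit_contract //; congr (_ * _).
  apply: eq_cycprods => [x|x xE|x k xE].
  - by rewrite !inE; case: (x == j); case: (x \in T); case: (x \in porbit s i).
  - apply/porbit_setP => y; apply/porbitP/porbitP => -[k ->]; exists k;
      rewrite perm_contract_iter_out //; by move: xE; rewrite in_setU negb_or => /andP[].
  - by rewrite perm_contract_iter_out //; move: xE; rewrite in_setU negb_or => /andP[].
rewrite /cycpath porbit_contract // cardsU1.
have -> : j \notin porbit s i.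
  by rewrite porbit_sym; apply/negP => /porbitP[k]; rewrite permX_fix // => /eqP; rewrite (negbTE ij).
have o0 : (0 < #|porbit s i|)%N by rewrite lt0n card_porbit_neq0.
rewrite add1n /= -[in LHS](prednK o0) big_ord_recr /=; congr (_ * _).
  apply: eq_bigr => k _.
  have lk : (k.+1 < #|porbit s i|)%N by have := ltn_ord k; rewrite -ltnS prednK.
  by rewrite !perm_contract_iter // ltnW.
rewrite perm_contract_iter ?prednK // perm_pred_porbit; congr (F _ _).
rewrite -[X in (_ ^+ X)%g](prednK o0) expgSr permM perm_contract_iter ?prednK //.
by rewrite permM perm_pred_porbit permKV tpermL.
Qed.

End PermutationExpansion.

(** * Extending permutations of a subset *)

Section PermExtension.
Variables (k n : nat) (e : 'I_k -> 'I_n) (e_inj : injective e).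
Implicit Types s t : 'S_k.

Definition perm_ext_fun s (x : 'I_n) : 'I_n :=
  if [pick a | e a == x] is Some a then e (s a) else x.

Lemma perm_ext_funE s a : perm_ext_fun s (e a) = e (s a).
Proof.
rewrite /perm_ext_fun; case: pickP => [b /eqP/e_inj -> // | /(_ a)].
by rewrite eqxx.
Qed.

Lemma perm_ext_fun_out s x : x \notin e @: setT -> perm_ext_fun s x = x.
Proof.
move=> xe; rewrite /perm_ext_fun; case: pickP => // a /eqP ax.
by case/negP: xe; rewrite -ax imset_f.
Qed.

Lemma perm_ext_inj s : injective (perm_ext_fun s).
Proof.
apply: (can_inj (g := perm_ext_fun s^-1%g)) => x.
case: (boolP (x \in e @: setT)) => [/imsetP[a _ ->]|xe].
  by rewrite !perm_ext_funE permK.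
by rewrite !perm_ext_fun_out.
Qed.

Definition perm_ext s : 'S_n := perm (@perm_ext_inj s).

Lemma perm_extE s a : perm_ext s (e a) = e (s a).
Proof. by rewrite permE perm_ext_funE. Qed.

Lemma perm_ext_out s x : x \notin e @: setT -> perm_ext s x = x.
Proof. by move=> xe; rewrite permE perm_ext_fun_out. Qed.

Lemma perm_extM s t : perm_ext (s * t) = (perm_ext s * perm_ext t)%g.
Proof.
apply/permP => x; case: (boolP (x \in e @: setT)) => [/imsetP[a _ ->]|xe].
  by rewrite permM !perm_extE permM.
by rewrite permM !perm_ext_out.
Qed.

Lemma perm_ext1 : perm_ext 1 = 1%g.
Proof.
apply/permP => x; case: (boolP (x \in e @: setT)) => [/imsetP[a _ ->]|xe].
  by rewrite perm_extE !perm1.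
by rewrite perm_ext_out // perm1.
Qed.

Lemma perm_ext_tperm a b : perm_ext (tperm a b) = tperm (e a) (e b).
Proof.
apply/permP => x; case: (boolP (x \in e @: setT)) => [/imsetP[c _ ->]|xe].
  by rewrite perm_extE inj_tperm.
rewrite perm_ext_out // tpermD //; apply: contraNneq xe => <-; exact: imset_f.
Qed.

(** A decomposition into transpositions is carried to a decomposition of the same length. *)
Lemma odd_perm_ext s : odd_perm (perm_ext s) = odd_perm s.
Proof.
case: (prod_tpermP s) => ts -> _; elim: ts => [|[a b] ts IH].
  by rewrite !big_nil perm_ext1 !odd_perm1.
rewrite !big_cons perm_extM !odd_permM IH perm_ext_tperm !odd_tperm.
by rewrite (inj_eq e_inj).
Qed.

Lemma perm_ext_injective : injective perm_ext.
Proof.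
move=> s t st; apply/permP => a; apply: e_inj.
by rewrite -!perm_extE st.
Qed.

(** One inclusion is clear, and by injectivity both sides have [k] factorial elements. *)
Lemma perm_ext_onto : perm_ext @: setT = [set u | perm_on (e @: setT) u].
Proof.
apply/eqP; rewrite eqEcard; apply/andP; split.
  apply/subsetP => u /imsetP[s _ ->]; rewrite inE; apply/subsetP => x; rewrite inE.
  by apply: contraR => /perm_ext_out ->.
rewrite card_imset; last exact: perm_ext_injective.
rewrite cardsT card_Sn cardsE.
have -> : #|[pred u : 'S_n | perm_on (e @: setT) u]| = #|perm_on (e @: setT)| by apply: eq_card.
by rewrite card_perm card_imset // cardsT card_ord.
Qed.

Lemma perm_ext_iter s m a : ((perm_ext s) ^+ m)%g (e a) = e ((s ^+ m)%g a).
Proof.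
elim: m => [|m IH]; first by rewrite !expg0 !perm1.
by rewrite !expgSr !permM IH perm_extE.
Qed.

Lemma porbit_ext s a : porbit (perm_ext s) (e a) = e @: porbit s a.
Proof.
apply/setP => x; apply/porbitP/imsetP => [[m ->]|[b /porbitP[m ->] ->]].
  by exists ((s ^+ m)%g a); rewrite ?mem_porbit ?perm_ext_iter.
by exists m; rewrite perm_ext_iter.
Qed.

Hypothesis e_mono : forall a b, (e a <= e b)%N = (a <= b)%N.

(** An increasing embedding preserves the least element of each cycle and the order of these
    elements. *)
Lemma cycle_leaders_ext s i :
  cycle_leaders (~: (e @: setT) :|: porbit (perm_ext s) (e i)) (perm_ext s) =
  map e (leaders s i).
Proof.
apply: (irr_sorted_eq (@ltn_ord_trans n)) => [x||| x]; rewrite ?ltnn //; first exact: sorted_filter_ord.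
  rewrite sorted_map.
  have := sorted_filter_ord
    (fun x => (x \notin porbit s i) && [forall y in porbit s x, (x <= y)%N]).
  by apply: sub_sorted => a b /=; rewrite !ltnNge e_mono.
rewrite mem_cycle_leaders !inE negb_or negbK porbit_ext.
apply/andP/mapP => [[/andP[/imsetP[a _ ->] ai] /forall_inP mx]|[a aL ->]].
  exists a => //; rewrite mem_filter mem_enum andbT -(mem_imset _ _ e_inj) ai /=.
  apply/forall_inP => b bs; rewrite -e_mono mx // porbit_ext imset_f //.
move: aL; rewrite mem_filter mem_enum andbT => /andP[ai /forall_inP ma].
rewrite imset_f // mem_imset // ai; split => //; apply/forall_inP => y.
by rewrite porbit_ext => /imsetP[b bs ->]; rewrite e_mono ma.
Qed.

Lemma cycprod_ext (R : realType) (G : 'M[quat R]_n) s a :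
  cycprod (\matrix_(i, j) G (e i) (e j)) s a = cycprod G (perm_ext s) (e a).
Proof.
rewrite /cycprod porbit_ext card_imset //.
by apply: eq_bigr => m _; rewrite mxE !perm_ext_iter.
Qed.

End PermExtension.

(** [odd_perm] is the parity of the degree plus the number of cycles; there are at most [k] cycles,
    so the truncated subtraction is a true one. *)
Lemma sign_porbits (R : realType) k (s : 'S_k) :
  (-1) ^+ (k - #|porbits s|) = (-1) ^+ s :> quat R.
Proof.
rewrite -[LHS]signr_odd; congr (_ ^+ (nat_of_bool _)).
rewrite oddB /odd_perm ?card_ord //.
by rewrite -[X in (_ <= X)%N](card_ord k) leq_imset_card.
Qed.

(** * Determinants of principal submatrices as sums over permutations of the index set *)

Section Transfer.
Variables (R : realType) (n : nat).
Local Notation H := (quat R).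
Implicit Types (G F : 'M[H]_n) (T : {set 'I_n}).

Lemma cdet_atE k (A : 'M[H]_k) (i : 'I_k) : cdet_at A i = cdet i A.
Proof. by case: k A i => [|k] A i; [case: i | rewrite /cdet_at inord_val]. Qed.

Lemma rdet_atE k (A : 'M[H]_k) (i : 'I_k) : rdet_at A i = rdet i A.
Proof. by case: k A i => [|k] A i; [case: i | rewrite /rdet_at inord_val]. Qed.

Lemma index_enum_rank T i (iT : i \in T) : index i (enum T) = enum_rank_in iT i.
Proof.
rewrite -[in LHS](enum_rankK_in iT iT) /enum_val index_uniq ?enum_uniq //.
by rewrite -cardE.
Qed.

Lemma enum_val_mono T (a b : 'I_#|T|) : (enum_val a <= enum_val b)%N = (a <= b)%N.
Proof.
have srt : sorted (fun x y : 'I_n => (x < y)%N) (enum T).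
  by rewrite /(enum _) -enumT; apply: sorted_filter_ord.
have mono (c d : 'I_#|T|) : (c < d)%N -> (enum_val c < enum_val d)%N.
  move=> cd; rewrite (enum_val_nth (enum_val c)) [X in (_ < nat_of_ord X)%N](enum_val_nth (enum_val c)).
  apply: (sorted_ltn_nth (@ltn_ord_trans n)) => //; by rewrite inE -cardE.
case: (ltngtP a b) => [/mono/ltnW // | /mono | /val_inj ->]; last by rewrite leqnn.
by rewrite ltnNge => /negbTE.
Qed.

Lemma cdet_pr_perm G T i : i \in T ->
  cdet_pr G T i = \sum_(u : 'S_n | perm_on T u)
    (-1) ^+ u * (cycprods G (~: T :|: porbit u i) u * cycprod G u i).
Proof.
move=> iT; rewrite /cdet_pr (index_enum_rank iT) cdet_atE.
set a := enum_rank_in iT i.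
have ea : enum_val a = i by rewrite enum_rankK_in.
have e_inj := @enum_val_inj _ (mem T); have e_mono := @enum_val_mono T.
set e : 'I_#|T| -> 'I_n := @enum_val _ (mem T) in e_inj e_mono ea.
have eT : e @: setT = T.
  apply/setP => x; apply/imsetP/idP => [[b _ ->]|xT]; first exact: enum_valP.
  by exists (enum_rank_in iT x); rewrite // /e enum_rankK_in.
have := perm_ext_onto e_inj; rewrite eT => onto.
rewrite -big_set -onto big_imset /=; last by move=> s t _ _; apply: perm_ext_injective.
apply: eq_big => [s|s _]; first by rewrite inE.
rewrite sign_porbits odd_perm_ext -ea; congr (_ * _).
have PG : prsub G T = \matrix_(c, d) G (e c) (e d) by [].
rewrite PG cycprod_ext; congr (_ * _).
rewrite /cycprods -[X in ~: X]eT (cycle_leaders_ext e_inj e_mono) -map_rev big_map.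
by apply: eq_bigr => x _; rewrite cycprod_ext.
Qed.

(** Each term meets column [i] exactly once, in the closing factor of the distinguished cycle, which
    is the rightmost one; hence [b] enters linearly from the right. *)
Lemma cdet_pr_repl F T i (b : 'cV[H]_n) :
  i \in T -> cdet_pr (col_repl i b F) T i = (padj F T *m b) i 0.
Proof.
move=> iT; rewrite cdet_pr_perm // mxE.
under [RHS]eq_bigr => l _ do rewrite mxE mulr_suml.
rewrite (exchange_big_dep (fun s => perm_on T s)) /=; last by move=> l s _ /andP[].
apply: eq_bigr => s Ts.
rewrite (big_pred1 ((s^-1)%g i)) => [|l]; last first.
  by rewrite Ts iT /= andbT (can2_eq (permK s) (permKV s)).
rewrite -!mulrA; congr (_ * _); congr (_ * _).
  apply: eq_big_seq => x; rewrite mem_rev mem_cycle_leaders inE negb_or => /andP[/andP[_ xi] _].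
  apply: eq_bigr => k _; rewrite mxE ifN //; apply: contra xi => /eqP <-.
  by rewrite porbit_sym mem_porbit.
rewrite cycprod_path mxE eqxx; congr (_ * _).
(* An earlier visit to column [i] would repeat an element of the orbit before the cycle closes. *)
apply: eq_bigr => k _; rewrite mxE ifN //; apply/eqP => E.
have U := uniq_traject_porbit s i.
have o0 : (0 < #|porbit s i|)%N by rewrite lt0n card_porbit_neq0.
have lk : (k.+1 < #|porbit s i|)%N by have := ltn_ord k; rewrite -ltnS prednK.
have := @nth_uniq _ i (traject s i #|porbit s i|) 0 k.+1.
rewrite size_traject => /(_ o0 lk U); rewrite !nth_traject //.
by rewrite -(permX s i k.+1) E /= eqxx.
Qed.

Lemma qconj_prod_ord o (f : nat -> H) :
  qconj (\prod_(m < o) f m) = \prod_(m < o) qconj (f (o - m.+1)%N).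
Proof.
elim: o => [|o IH]; first by rewrite !big_ord0 qconj1.
by rewrite big_ord_recr big_ord_recl /= qconjM IH subSS subn0.
Qed.

Lemma cycprod_conj k (A : 'M[H]_k) s x :
  qconj (cycprod A s x) = cycprod (qadj A) s^-1%g x.
Proof.
rewrite /cycprod porbitV (qconj_prod_ord _ (fun m => A ((s ^+ m)%g x) ((s ^+ m.+1)%g x))).
have back m : (m <= #|porbit s x|)%N -> (s^-1 ^+ m)%g x = (s ^+ (#|porbit s x| - m))%g x.
  move=> mo; apply: (@perm_inj _ (s ^+ m)%g).
  by rewrite -!permM -expgD subnK // expgVn mulVg perm1 perm_iter_porbit.
apply: eq_bigr => m _; have mo := ltn_ord m.
by rewrite qadjE !back ?(ltnW mo) // subnSK.
Qed.

(** Conjugation reverses every product, which turns the row ordering of cycles into the column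
    ordering and runs each cycle backwards. Passing to [s^-1] restores the direction and keeps
    orbits, leaders and sign. *)
Lemma rdet_conj k (A : 'M[H]_k) i : rdet i A = qconj (cdet i (qadj A)).
Proof.
rewrite /rdet /cdet qconj_sum (reindex_inj invg_inj) /=.
apply: eq_bigr => s _; rewrite !sign_porbits odd_permV.
have Ld : leaders s^-1 i = leaders s i.
  by apply: eq_filter => x; rewrite !porbitV.
rewrite [RHS]qconjM qconj_sign (GRing.commr_sign (qconj _) s); congr (_ * _).
rewrite qconjM cycprod_conj qadjK qconj_prod revK Ld; congr (_ * _).
by apply: eq_bigr => x _; rewrite cycprod_conj qadjK.
Qed.

Lemma prsub_qadj G T : prsub (qadj G) T = qadj (prsub G T).
Proof. by apply/matrixP => a b; rewrite !(qadjE, mxE). Qed.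

Lemma rdet_pr_conj G T i : i \in T -> rdet_pr G T i = qconj (cdet_pr (qadj G) T i).
Proof.
move=> iT; rewrite /rdet_pr /cdet_pr (index_enum_rank iT) rdet_atE cdet_atE.
by rewrite rdet_conj prsub_qadj.
Qed.

(** Position 0 of [enum T] holds the least element of [T], so the left side is the conjugate of the
    column determinant there, and that column determinant is [pdet F T]. *)
Lemma hdet_prE F T : qadj F = F -> qconj (pdet F T) = pdet F T -> hdet_pr F T = pdet F T.
Proof.
move=> Fh dR; case: (set_0Vmem T) => [->|[x xT]].
  (* On the empty set both sides are 1, by the default value in [rdet_at]. *)
  by rewrite pdet0 /hdet_pr; move: (prsub _ _); rewrite cards0.
case: (@arg_minnP _ x (mem T) (fun y : 'I_n => y : nat) xT) => m mT mmin.
have -> : hdet_pr F T = rdet_pr F T m.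
  rewrite /hdet_pr /rdet_pr; congr (rdet_at _ _).
  rewrite (index_enum_rank mT); apply/esym/eqP; rewrite -leqn0.
  have T0 : (0 < #|T|)%N by apply/card_gt0P; exists m.
  rewrite -[X in (_ <= X)%N]/(nat_of_ord (Ordinal T0)) -enum_val_mono enum_rankK_in //.
  by apply: mmin; apply: enum_valP.
rewrite rdet_pr_conj // Fh.
have E : F = col_repl m (col m F) F.
  by apply/matrixP => a b; rewrite !mxE; case: eqP => // ->.
rewrite {1}E cdet_pr_repl // -[RHS]dR (pdet_min F mT mmin); congr qconj.
by rewrite !mxE; apply: eq_bigr => l _; congr (_ * _); rewrite mxE.
Qed.

End Transfer.

(** * Cramer's rule for Hermitian matrices *)

Local Opaque padj pdet.

Section HermitianAdjugate.
Variables (R : realType) (n : nat).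
Local Notation H := (quat R).
Variable F : 'M[H]_n.
Hypothesis Fh : qadj F = F.
Implicit Types (S T V : {set 'I_n}).
Local Notation D := (pdet F).
Local Notation L := (padj F).

Lemma set_argmin T : T != set0 ->
  exists2 m, m \in T & forall x : 'I_n, x \in T -> (m <= x)%N.
Proof.
case/set0Pn => x xT.
by case: (@arg_minnP _ x (mem T) (fun y : 'I_n => y : nat) xT) => m mT mmin; exists m.
Qed.

Lemma sum_padjl T i j (G : 'M[H]_n) :
  (L T *m G) i j = \sum_(l in T) L T i l * G l j.
Proof.
rewrite mxE (bigID (mem T)) /= [X in _ + X]big1 ?addr0 // => l lT.
by rewrite padj_outr // mul0r.
Qed.

Lemma sum_padjr T i j (G : 'M[H]_n) :
  (G *m L T) i j = \sum_(l in T) G i l * L T l j.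
Proof.
rewrite mxE (bigID (mem T)) /= [X in _ + X]big1 ?addr0 // => l lT.
by rewrite padj_outl // mulr0.
Qed.

(** For distinct [i] and [j] in [T], let [U] be [T] without both. Peeling off [j] on the right and
    [i] on the left, in either order, gives [D U * F i j] minus the [i j] entry of [F *m L U *m F],
    once [D U] is central. Reality of smaller minors is a hypothesis because [pdet_real] calls this
    lemma within its own induction. *)
Lemma padj_recl_real T i j : (forall U : {set 'I_n}, U \proper T -> qconj (D U) = D U) ->
  i \in T -> L T i j = (i == j)%:R * D (T :\ i) - (F *m L (T :\ i)) i j.
Proof.
have [k] := ubnP #|T|; elim: k T i j => // k IH T i j /ltnSE-Tk Dr iT.
case: (boolP (j \in T)) => jT; last first.
  rewrite padj_outr // (negbTE (memPn jT _ iT)) mul0r sub0r sum_padjr big1 ?oppr0 //.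
  by move=> l _; rewrite padj_outr ?mulr0 // !inE (negbTE jT) andbF.
rewrite padj_rec //; case: (eqVneq i j) => [<-|ij].
  rewrite sum_padjl sum_padjr !big1 // => l _.
    by rewrite padj_outr ?mulr0 // setD11.
  by rewrite padj_outl ?mul0r // setD11.
rewrite !mul0r !sub0r; congr (- _).
have iTj : i \in T :\ j by rewrite !inE ij.
have jTi : j \in T :\ i by rewrite !inE eq_sym ij.
have E : (T :\ j) :\ i = (T :\ i) :\ j by rewrite !setDDl setUC.
have pT x : x \in T -> T :\ x \proper T by move=> xT; apply: properD1.
rewrite sum_padjl sum_padjr.
under eq_bigr => l lTj.
  rewrite (IH (T :\ j) i l) //.
  - rewrite mulrBl.
    over.
  - by apply: leq_trans (proper_card (pT _ jT)) Tk.
  - by move=> U UT; apply: Dr; apply: proper_trans UT (pT _ jT).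
under [RHS]eq_bigr => l lTi do rewrite padj_rec // mulrBr.
rewrite !sumrB; congr (_ - _).
  rewrite (bigD1 i) //= eqxx mul1r big1 ?addr0 => [|l /andP[_ li]]; last first.
    by rewrite eq_sym (negbTE li) !mul0r.
  rewrite [RHS](bigD1 j) //= eqxx mul1r big1 ?addr0 => [|l /andP[_ lj]]; last first.
    by rewrite (negbTE lj) mul0r mulr0.
  rewrite E qreal_central //; apply: Dr.
  by apply: proper_trans (pT _ iT); apply: properD1.
transitivity ((F *m L ((T :\ j) :\ i) *m F) i j).
  rewrite [RHS]mxE [RHS](bigID (mem (T :\ j))) /= [X in _ = _ + X]big1 ?addr0 // => l lTj.
  rewrite sum_padjr big1 ?mul0r // => l' _.
  by rewrite padj_outr ?mulr0 // inE negb_and lTj orbT.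
rewrite -mulmxA E mxE (bigID (mem (T :\ i))) /= [X in _ + X = _]big1 ?addr0 // => l lTi.
rewrite sum_padjl big1 ?mulr0 // => l' _.
by rewrite padj_outl ?mul0r // inE negb_and lTi orbT.
Qed.

(** Expanding at the least element [m] and then peeling it off on the left writes [D T] as a product
    of two reals minus a diagonal entry of the Hermitian matrix [F *m L (T :\ m) *m F]. *)
Lemma pdet_real T : qconj (D T) = D T.
Proof.
have [k] := ubnP #|T|; elim: k T => // k IH T /ltnSE-Tk.
have Dr : forall U : {set 'I_n}, U \proper T -> qconj (D U) = D U.
  by move=> U UT; apply: IH; apply: leq_trans (proper_card UT) Tk.
case: (eqVneq T set0) => [->|/set_argmin[m mT mmin]]; first by rewrite pdet0 qconj1.
(* Conjugation exchanges the right recursion [padj_rec] with its left mirror image. *)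
have herm (U : {set _}) : U \proper T -> forall i j, qconj (L U i j) = L U j i.
  have [k'] := ubnP #|U|; elim: k' U => // k' IH' U /ltnSE-Uk UT i j.
  have DrU (V : {set _}) : V \proper U -> qconj (D V) = D V.
    by move=> VU; apply: Dr; apply: proper_trans VU UT.
  case: (boolP (j \in U)) => jU; last by rewrite padj_outr // padj_outl // qconj0.
  rewrite padj_rec // [RHS]padj_recl_real // qconjD qconjN qconjM eq_sym.
  have pU := properD1 jU.
  congr (_ - _).
    by rewrite DrU //; case: (j == i); rewrite ?qconj1 ?qconj0 ?mulr1 ?mul1r ?mulr0 ?mul0r.
  rewrite !mxE qconj_sum; apply: eq_bigr => l _.
  rewrite qconjM IH' //; last by apply: proper_trans pU UT.
    by congr (_ * _); rewrite -qadjE Fh.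
  by apply: leq_trans (proper_card pU) Uk.
rewrite (pdet_min F mT mmin).
have pT := properD1 mT.
have -> : (L T *m F) m m = D (T :\ m) * F m m - (F *m L (T :\ m) *m F) m m.
  rewrite mxE.
  under eq_bigr => l _ do rewrite padj_recl_real // mulrBl.
  rewrite sumrB [X in _ = _ - X]mxE; congr (_ - _).
  rewrite (bigD1 m) //= eqxx mul1r big1 ?addr0 // => l lm.
  by rewrite eq_sym (negbTE lm) !mul0r.
have Fhe i j : qconj (F i j) = F j i by rewrite -qadjE Fh.
rewrite qconjD qconjN; congr (_ - _).
  by rewrite qmul_realM // Dr.
have Lh : qadj (L (T :\ m)) = L (T :\ m).
  by apply/matrixP => i j; rewrite qadjE herm.
have FLFh : qadj (F *m L (T :\ m) *m F) = F *m L (T :\ m) *m F.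
  by rewrite !qadjM Fh Lh mulmxA.
by rewrite -[in LHS]FLFh qadjE qconjK.
Qed.

Lemma padj_recl T i j :
  i \in T -> L T i j = (i == j)%:R * D (T :\ i) - (F *m L (T :\ i)) i j.
Proof. by apply: padj_recl_real => U _; apply: pdet_real. Qed.

Lemma padj_herm T : qadj (L T) = L T.
Proof.
apply/matrixP => i j; rewrite qadjE.
have [k] := ubnP #|T|; elim: k T i j => // k IH T i j /ltnSE-Tk.
case: (boolP (i \in T)) => iT; last by rewrite padj_outr // padj_outl // qconj0.
rewrite padj_rec // [RHS]padj_recl // qconjD qconjN qconjM eq_sym.
congr (_ - _).
  by rewrite pdet_real //; case: (i == j); rewrite ?qconj1 ?qconj0 ?mulr1 ?mul1r ?mulr0 ?mul0r.
rewrite !mxE qconj_sum; apply: eq_bigr => l _; rewrite qconjM IH.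
  by congr (_ * _); rewrite -qadjE Fh.
by apply: leq_trans (proper_card (properD1 iT)) Tk.
Qed.

Lemma padj_mul_rec T i j : i \in T ->
  (L T *m F) i j = D (T :\ i) * F i j - (F *m L (T :\ i) *m F) i j.
Proof.
move=> iT; rewrite mxE.
under eq_bigr => l _ do rewrite padj_recl // mulrBl.
rewrite sumrB [X in _ = _ - X]mxE; congr (_ - _).
rewrite (bigD1 i) //= eqxx mul1r big1 ?addr0 // => l lm.
by rewrite eq_sym (negbTE lm) !mul0r.
Qed.

(* Serves [padj_mulE]: there [F i m * del m = del i * F i m] makes the diagonal entries
   [del] of [L T *m F] equal only when [F i m <> 0]. *)
Lemma pdet_block S V : [disjoint S & V] ->
  (forall i j, i \in S -> j \in V -> F i j = 0) ->
  D (S :|: V) = D S * D V /\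
  (forall i j, i \in S -> L (S :|: V) i j = L S i j * D V).
Proof.
have [k] := ubnP #|S :|: V|; elim: k S V => // k IH.
have Fhe i j : qconj (F i j) = F j i by rewrite -qadjE Fh.
have adj S V : (#|S :|: V| <= k)%N -> [disjoint S & V] ->
    (forall i j, i \in S -> j \in V -> F i j = 0) ->
    forall i j, i \in S -> L (S :|: V) i j = L S i j * D V.
  move=> SVk SV FSV i j iS.
  have SD x : x \in S -> (S :\ x) :|: V = (S :|: V) :\ x.
    move=> xS; rewrite setDUl [V :\ x](_ : _ = V) //; apply/setDidPl.
    by rewrite disjoint_sym disjoints1 (disjointFr SV xS).
  have VD x : x \in V -> S :|: (V :\ x) = (S :|: V) :\ x.
    move=> xV; rewrite setDUl [S :\ x](_ : _ = S) //; apply/setDidPl.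
    by rewrite disjoint_sym disjoints1 (disjointFl SV xV).
  have small x : x \in S :|: V -> (#|(S :|: V) :\ x| < k)%N.
    by move=> xU; apply: leq_trans (proper_card (properD1 xU)) SVk.
  have dS x : [disjoint S :\ x & V] by apply: disjointWl SV; apply: subsetDl.
  have dV x : [disjoint S & V :\ x] by apply: disjointWr SV; apply: subsetDl.
  case: (boolP (j \in S)) => jS.
    have jSV : j \in S :|: V by rewrite inE jS.
    have FjSV a b : a \in S :\ j -> b \in V -> F a b = 0 by rewrite inE => /andP[_]; apply: FSV.
    have := IH (S :\ j) V; rewrite (SD _ jS) => /(_ (small _ jSV) (dS j) FjSV) [DSV LSV].
    rewrite padj_rec // [L S i j]padj_rec // DSV mulrBl mulrA; congr (_ - _).
    rewrite !mxE mulr_suml; apply: eq_bigr => l _.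
    case: (eqVneq i j) => [->|ij].
      by rewrite [L ((S :|: V) :\ j) j l]padj_outl ?[L (S :\ j) j l]padj_outl ?mul0r // !inE eqxx.
    rewrite LSV ?inE ?ij // -!mulrA; congr (_ * _).
    by rewrite qreal_central // pdet_real.
  rewrite [L S i j]padj_outr // mul0r.
  case: (boolP (j \in V)) => jV; last by rewrite padj_outr // inE negb_or jS.
  have jSV : j \in S :|: V by rewrite inE jV orbT.
  have FSVj a b : a \in S -> b \in V :\ j -> F a b = 0 by rewrite inE => aS /andP[_]; apply: FSV.
  have := IH S (V :\ j); rewrite (VD _ jV) => /(_ (small _ jSV) (dV j) FSVj) [_ LSV].
  (* After peeling off [j] in [V], the cofactors at [i] live on columns [l] in [S], where [F l j]
     vanishes. *)
  rewrite padj_rec // (negbTE (memPn jS _ iS)) mul0r sub0r mxE big1 ?oppr0 // => l _.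
  rewrite LSV //; case: (boolP (l \in S)) => lS; last by rewrite padj_outr // !mul0r.
  by rewrite FSV // mulr0.
(* Both determinants are expanded at the least element of the union, here assumed to lie in [S]; the
   other case exchanges the blocks. *)
have detm S V m : (#|S :|: V| <= k)%N -> [disjoint S & V] ->
    (forall i j, i \in S -> j \in V -> F i j = 0) ->
    m \in S -> (forall x, x \in S :|: V -> (m <= x)%N) -> D (S :|: V) = D S * D V.
  move=> SVk SV FSV mS mmin.
  rewrite (@pdet_min _ _ F (S :|: V) m) //; last by rewrite inE mS.
  rewrite (@pdet_min _ _ F S m) //; last by move=> x xS; apply: mmin; rewrite inE xS.
  rewrite !mxE mulr_suml; apply: eq_bigr => l _.
  by rewrite adj // -!mulrA; congr (_ * _); rewrite qreal_central // pdet_real.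
move=> S V /ltnSE-SVk SV FSV; split; last exact: adj.
case: (eqVneq (S :|: V) set0) => [|/set_argmin[m mSV mmin]].
  by move=> /eqP; rewrite setU_eq0 => /andP[/eqP-> /eqP->]; rewrite setU0 pdet0 mulr1.
case/setUP: (mSV) => [mS|mV]; first exact: detm mmin.
rewrite setUC [RHS]qreal_central ?pdet_real //; apply: detm mV _; rewrite 1?setUC //.
- by rewrite disjoint_sym.
- by move=> i j iV jS; rewrite -Fhe FSV // qconj0.
Qed.

(** Off the diagonal, [padj_mul_rec] and induction leave [D (T :\ a) * F a b - F a b * D (T :\ a)],
    which is 0 by centrality. The diagonal entries [del] are real, and bracketing [F *m L T *m F] in
    two ways relates them through [F]; it remains to show that they all equal the one at the least
    element. *)
Lemma padj_mulE T i j : i \in T -> j \in T -> (L T *m F) i j = (i == j)%:R * D T.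
Proof.
have [k] := ubnP #|T|; elim: k T i j => // k IH T i j /ltnSE-Tk.
have Fhe a b : qconj (F a b) = F b a by rewrite -qadjE Fh.
have off a b : a \in T -> b \in T -> a != b -> (L T *m F) a b = 0.
  move=> aT bT ab; rewrite padj_mul_rec // -mulmxA mxE.
  rewrite (bigD1 b) //= big1 ?addr0 => [|l lb].
    rewrite IH ?eqxx ?mul1r ?inE ?(eq_sym b) ?ab //.
      by rewrite qreal_central ?pdet_real // subrr.
    by apply: leq_trans (proper_card (properD1 aT)) Tk.
  case: (boolP (l \in T :\ a)) => lTa.
    rewrite (IH (T :\ a)) // ?(negbTE lb) ?mul0r ?mulr0 //; last first.
      by rewrite !inE eq_sym ab.
    by apply: leq_trans (proper_card (properD1 aT)) Tk.
  by rewrite sum_padjl big1 ?mulr0 // => l' _; rewrite padj_outl // mul0r.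
move=> iT jT; case: (eqVneq i j) => [<-|]; last by rewrite mul0r; apply: off.
rewrite mul1r; have /set_argmin[m mT mmin] : T != set0 by apply/set0Pn; exists i.
rewrite (pdet_min F mT mmin).
pose del a := (L T *m F) a a.
have delr a : a \in T -> qconj (del a) = del a.
  move=> aT; rewrite /del padj_mul_rec // qconjD qconjN; congr (_ - _).
    by rewrite qmul_realM ?pdet_real.
  have FLFh : qadj (F *m L (T :\ a) *m F) = F *m L (T :\ a) *m F.
    by rewrite !qadjM Fh padj_herm mulmxA.
  by rewrite -[in LHS]FLFh qadjE qconjK.
have FL : F *m L T = qadj (L T *m F) by rewrite qadjM padj_herm Fh.
have comm a b : a \in T -> b \in T -> F a b * del b = del a * F a b.
  move=> aT bT; transitivity (\sum_(l in T) F a l * (L T *m F) l b).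
    rewrite (bigD1 b) //= big1 ?addr0 // => l /andP[lT lb].
    by rewrite off // mulr0.
  transitivity ((F *m L T *m F) a b).
    rewrite -mulmxA [RHS]mxE [RHS](bigID (mem T)) /= [X in _ = _ + X]big1 ?addr0 // => l lT.
    by rewrite sum_padjl big1 ?mulr0 // => l' _; rewrite padj_outl // mul0r.
  rewrite mxE (bigID (mem T)) /= [X in _ + X]big1 ?addr0 => [|l lT].
    rewrite (bigD1 a) //= big1 ?addr0 => [|l /andP[lT la]].
      by rewrite FL qadjE delr.
    by rewrite FL qadjE off // qconj0 mul0r.
  by rewrite sum_padjr big1 ?mul0r // => l' _; rewrite padj_outr // mulr0.
apply/eqP; apply: contraT => ne.
(* If [del i] and [del m] differ, the level set of [del i] splits [T] into two proper parts between
   which [comm] forces [F] to vanish. *)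
pose S := [set a in T | del a == del i]; pose V := T :\: S.
have iS : i \in S by rewrite inE iT eqxx.
have mV : m \in V by rewrite !inE mT /= andbT /= eq_sym.
have ST : S \subset T by apply/subsetP => a; rewrite inE => /andP[].
have VT : V \subset T by apply: subsetDl.
have SV : [disjoint S & V].
  by rewrite -setI_eq0; apply/eqP/setP => a; rewrite !inE; case: (a \in T) => //=; rewrite andbT andbN.
have TSV : T = S :|: V by apply/setP => a; rewrite !inE; case: (a \in T) => //=; rewrite andbT orbN.
have FSV a b : a \in S -> b \in V -> F a b = 0.
  move=> aS bV; have aT := subsetP ST _ aS; have bT := subsetP VT _ bV.
  have := comm _ _ aT bT; rewrite -qreal_central ?delr // => E.
  have : (del b - del a) * F a b = 0 by rewrite mulrBl E subrr.
  move=> E0; apply/eqP; apply: contraT => Fn0.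
  have := qreal_mul_eq0 _ E0 Fn0; rewrite qconjD qconjN !delr // => /(_ erefl)/eqP.
  rewrite subr_eq0; move: aS bV; rewrite !inE => /andP[_ /eqP ->] /andP[].
  by rewrite negb_and => /orP[/negP|/negbTE ->].
have FVS a b : a \in V -> b \in S -> F a b = 0.
  by move=> aV bS; rewrite -Fhe FSV // qconj0.
(* In a block decomposition [del] is the product of the two block minors on either block, so
   [del i = del m] after all. *)
have key S' V' a : T = S' :|: V' -> [disjoint S' & V'] -> (#|S'| < k)%N ->
    (forall a b, a \in S' -> b \in V' -> F a b = 0) -> a \in S' -> del a = D S' * D V'.
  move=> TE dj Sk F0 aS; have [_ LE] := pdet_block dj F0.
  rewrite /del {1}TE mxE.
  under eq_bigr => l _ do rewrite LE // -mulrA (qreal_central _ (pdet_real V')) mulrA.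
  rewrite -mulr_suml; congr (_ * _).
  by have := IH S' a a Sk aS aS; rewrite eqxx mul1r => <-; rewrite [RHS]mxE.
have cS : (#|S| < k)%N.
  apply: leq_trans Tk; apply: proper_card; rewrite properE ST.
  by apply/subsetPn; exists m => //; move: mV; rewrite inE => /andP[].
have cV : (#|V| < k)%N.
  apply: leq_trans Tk; apply: proper_card; rewrite properE VT.
  by apply/subsetPn; exists i => //; rewrite inE iS.
case/eqP: ne; rewrite -/(del i) -/(del m) (key S V i) // (key V S m) //.
- by rewrite qreal_central ?pdet_real.
- by rewrite setUC.
- by rewrite disjoint_sym.
Qed.

Definition padjs k : 'M[H]_n := \sum_(T : {set 'I_n} | #|T| == k) L T.
Definition pdets k : H := \sum_(T : {set 'I_n} | #|T| == k) D T.

Lemma pdets_real k : qconj (pdets k) = pdets k.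
Proof. by rewrite /pdets qconj_sum; apply: eq_bigr => T _; apply: pdet_real. Qed.

(** In the first sum only sets containing [j] matter; removing [j] maps them onto the sets of size
    [k] without [j], and [padj_rec] produces a term that cancels against these sets in the second
    sum. The sets of size [k] containing [j] are evaluated by [padj_mulE]. *)
Lemma padjs_rec k i j :
  padjs k.+1 i j + (padjs k *m F) i j = (i == j)%:R * pdets k.
Proof.
rewrite /padjs mulmx_suml !summxE (bigID (fun T : {set 'I_n} => j \in T)) /=.
rewrite [X in _ + X + _]big1 ?addr0 => [|T /andP[_ jT]]; last by rewrite padj_outr.
rewrite [X in _ + X](bigID (fun T : {set 'I_n} => j \in T)) /=.
have -> : \sum_(T : {set 'I_n} | (#|T| == k.+1) && (j \in T)) L T i j =
   \sum_(T : {set 'I_n} | (#|T| == k) && (j \notin T)) ((i == j)%:R * D T - (L T *m F) i j).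
  rewrite [RHS](reindex_onto (fun T => T :\ j) (fun T => j |: T)) /=; last first.
    by move=> T /andP[_ jT]; rewrite setU1K.
  apply: eq_big => [T|T /andP[_ jT]]; last exact: padj_rec.
  rewrite !inE eqxx /= andbT; case: (boolP (j \in T)) => jT.
    by rewrite setD1K // eqxx !andbT (cardsD1 j T) jT add1n eqSS.
  rewrite !andbF; symmetry; apply/negbTE; rewrite negb_and; apply/orP; right.
  by apply: contra jT => /eqP <-; rewrite !inE eqxx.
have -> : \sum_(T : {set 'I_n} | (#|T| == k) && (j \in T)) (L T *m F) i j =
   \sum_(T : {set 'I_n} | (#|T| == k) && (j \in T)) (i == j)%:R * D T.
  apply: eq_bigr => T /andP[_ jT].
  case: (boolP (i \in T)) => iT; first exact: padj_mulE.
  rewrite sum_padjl big1 => [|l _]; last by rewrite padj_outl // mul0r.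
  by rewrite eq_sym (negbTE (memPn iT _ jT)) mul0r.
have alg (a b c : H) : (a - b) + (c + b) = c + a by rewrite [c + b]addrC addrA subrK addrC.
rewrite sumrB /pdets [in RHS](bigID (fun T : {set 'I_n} => j \in T)) /= mulrDr !mulr_sumr.
exact: alg.
Qed.

End HermitianAdjugate.

(** * Gram matrices and rank *)

Section Gram.
Variables (R : realType) (m n : nat).
Local Notation H := (quat R).
Variable A : 'M[H]_(m, n).
Implicit Types T : {set 'I_n}.
Local Notation F := (qadj A *m A).
Local Notation D := (pdet F).
Local Notation L := (padj F).

Lemma gram_herm : qadj F = F.
Proof. by rewrite qadjM qadjK. Qed.

(** If [A *m v = 0] with [v] supported on [T], applying [L T *m qadj A] gives [D T * v i 0 = 0],
    with [D T] real. *)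
Lemma pdet_indep T : D T != 0 -> cols_indep A T.
Proof.
move=> Dn0 v vT Av; apply/colP => i; rewrite mxE.
case: (boolP (i \in T)) => iT; last exact: vT.
apply/eqP; apply: contraNT Dn0 => vn0; apply/eqP.
apply: (qreal_mul_eq0 (pdet_real gram_herm T)) vn0.
have : (L T *m F *m v) i 0 = 0 by rewrite -!mulmxA Av !mulmx0 mxE.
rewrite mxE (bigD1 i) //= big1 ?addr0 => [|j ji].
  by rewrite padj_mulE ?gram_herm // eqxx mul1r.
case: (boolP (j \in T)) => jT; last by rewrite vT // mulr0.
by rewrite padj_mulE ?gram_herm // eq_sym (negbTE ji) !mul0r.
Qed.

Lemma cols_indepS (S T : {set 'I_n}) : S \subset T -> cols_indep A T -> cols_indep A S.
Proof.
move=> ST Ti v vS; apply: Ti => j jT; apply: vS.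
by apply: contra jT; apply: (subsetP ST).
Qed.

(** Column [i] of [L T] is a vector [u] supported on [T] with [i]th entry [D (T :\ i)], positive by
    induction. Thus [A *m u] is nonzero, and its squared norm is [D (T :\ i) * D T]. *)
Lemma pdet_gt0 T : cols_indep A T -> 0 < qc (D T) 0.
Proof.
have [k] := ubnP #|T|; elim: k T => // k IH T /ltnSE-Tk Ti.
case: (set_0Vmem T) => [->|[i iT]]; first by rewrite pdet0 qoneE qc_mk0.
have D'0 : 0 < qc (D (T :\ i)) 0.
  apply: IH; first by apply: leq_trans (proper_card (properD1 iT)) Tk.
  by apply: cols_indepS Ti; apply: subsetDl.
pose u := col i (L T).
have ui : u i 0 = D (T :\ i).
  rewrite mxE padj_rec // eqxx mul1r sum_padjl big1 ?subr0 // => l _.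
  by rewrite padj_outl ?mul0r // setD11.
have uT j : j \notin T -> u j 0 = 0 by move=> jT; rewrite mxE padj_outl.
have Du : qc ((qadj (A *m u) *m (A *m u)) 0 0) 0 = qc (D (T :\ i)) 0 * qc (D T) 0.
  rewrite -qc0_realM ?pdet_real ?gram_herm //; congr qc.
  rewrite qadjM -mulmxA [X in _ *m X]mulmxA mxE (bigD1 i) //= big1 ?addr0 => [|j ji].
    rewrite qadjE ui pdet_real ?gram_herm //; congr (_ * _).
    have -> : F *m u = col i (qadj (L T *m F)).
      by rewrite qadjM padj_herm ?gram_herm // /u !colE mulmxA.
    by rewrite mxE qadjE padj_mulE ?gram_herm // eqxx mul1r pdet_real ?gram_herm.
  rewrite qadjE; case: (boolP (j \in T)) => jT; last by rewrite uT // qconj0 mul0r.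
  have -> : F *m u = col i (qadj (L T *m F)).
    by rewrite qadjM padj_herm ?gram_herm // /u !colE mulmxA.
  rewrite [X in _ * X]mxE qadjE padj_mulE ?gram_herm //.
  by rewrite eq_sym (negbTE ji) mul0r qconj0 mulr0.
have : qc ((qadj (A *m u) *m (A *m u)) 0 0) 0 != 0.
  apply/eqP => /gram_col_eq0/(Ti u uT) u0; move: D'0.
  by rewrite -ui u0 mxE qc0 ltxx.
have := qc0_gram (A *m u); rewrite le0r => /orP[/eqP->|]; first by rewrite eqxx.
by rewrite Du pmulr_rgt0.
Qed.

(** The product of [L T *m qadj A] with its adjoint is [L T *m F *m qadj (L T)], which vanishes with
    [D T]. *)
Lemma padj_dep T : D T = 0 -> L T *m qadj A = 0.
Proof.
move=> D0; apply: qadj_mul_eq0; rewrite qadjM qadjK mulmxA -(mulmxA (L T)).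
apply/matrixP => i j; rewrite [RHS]mxE mxE big1 // => l _.
case: (boolP (l \in T)) => lT; last by rewrite qadjE padj_outr // qconj0 mulr0.
case: (boolP (i \in T)) => iT.
  by rewrite padj_mulE ?gram_herm // D0 mulr0 mul0r.
by rewrite sum_padjl big1 ?mul0r // => l' _; rewrite padj_outl // mul0r.
Qed.

Variables (k : nat) (Ak : qrank A k).

(** All minors are nonnegative, and an independent set of size [k] contributes a positive one. *)
Lemma pdets_neq0 : pdets F k != 0.
Proof.
have [[S Sk Si] _] := Ak.
suff : 0 < qc (pdets F k) 0 by apply: contraTneq => ->; rewrite qc0 ltxx.
rewrite /pdets qc_sum (bigD1 S) /=; last by rewrite Sk.
apply: ltr_wpDr; last exact: pdet_gt0.
apply: sumr_ge0 => T _; case: (eqVneq (D T) 0) => [->|]; first by rewrite qc0.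
by move/pdet_indep/pdet_gt0/ltW.
Qed.

Lemma padjs_rank_succ : padjs F k.+1 *m qadj A = 0.
Proof.
rewrite /padjs mulmx_suml big1 // => T /eqP Tk; apply: padj_dep.
apply/eqP; apply: contraT => /pdet_indep; case: Ak => _ /[apply].
by rewrite Tk ltnn.
Qed.

Variables (X : 'M[H]_(n, m)) (AX : is_MP A X).

Lemma MP_adj : F *m X = qadj A.
Proof.
have [AXA _ AXh _] := AX.
by rewrite -mulmxA -AXh -qadjM AXA.
Qed.

(** Lets whatever annihilates [qadj A] from the left, such as [padjs F k.+1], annihilate [X] too. *)
Lemma MP_adj_factor : X = qadj A *m (qadj X *m X).
Proof.
by have [_ XAX _ XAh] := AX; rewrite mulmxA -qadjM XAh XAX.
Qed.

Lemma padjs_MP i j : (padjs F k *m qadj A) i j = pdets F k * X i j.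
Proof.
have E : padjs F k *m F = \matrix_(a, b) ((a == b)%:R * pdets F k) - padjs F k.+1.
  apply/matrixP => a b; have := padjs_rec gram_herm k a b.
  by rewrite !mxE => <-; rewrite addrC addKr.
have -> : padjs F k *m qadj A = padjs F k *m F *m X by rewrite -[RHS]mulmxA MP_adj.
have E0 : padjs F k.+1 *m X = 0.
  by rewrite [in LHS]MP_adj_factor mulmxA padjs_rank_succ mul0mx.
rewrite E mulmxBl E0 subr0 mxE (bigD1 i) //= big1 ?addr0 => [|l li].
  by rewrite mxE eqxx mul1r.
by rewrite mxE eq_sym (negbTE li) !mul0r.
Qed.

(* [padjs F k *m F = pdets F k * (X *m A)], and the real trace of the left side is
   [\sum_T #|T| * D T = k * pdets F k]. *)
Lemma qrank_trace : \sum_i qc ((X *m A) i i) 0 = k%:R.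
Proof.
have dn0 : qc (pdets F k) 0 != 0.
  apply: contra pdets_neq0 => /eqP E; apply/eqP.
  by apply: qreal_eq; rewrite ?pdets_real ?gram_herm ?qconj0 ?qc0.
apply: (mulfI dn0); rewrite mulr_sumr.
have E i : qc (pdets F k) 0 * qc ((X *m A) i i) 0 =
    \sum_(T : {set 'I_n} | #|T| == k) (i \in T)%:R * qc (D T) 0.
  rewrite -qc0_realM ?pdets_real ?gram_herm //.
  have -> : pdets F k * (X *m A) i i = (padjs F k *m F) i i.
    rewrite mulmxA !mxE mulr_sumr; apply: eq_bigr => l _.
    by rewrite padjs_MP mulrA.
  rewrite /padjs mulmx_suml summxE qc_sum; apply: eq_bigr => T _.
  case: (boolP (i \in T)) => iT; first by rewrite padj_mulE ?gram_herm // eqxx !mul1r.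
  by rewrite sum_padjl big1 ?mul0r ?qc0 // => l _; rewrite padj_outl // mul0r.
under eq_bigr => i _ do rewrite E.
rewrite exchange_big /= /pdets qc_sum mulr_suml; apply: eq_bigr => T /eqP Tk.
by rewrite -mulr_suml -natr_sum -big_mkcond /= sum1_card Tk mulrC.
Qed.

End Gram.

(** * Rank of the conjugate transpose *)

Section RankAdjoint.
Variable R : realType.
Local Notation H := (quat R).

(** Independence is made boolean classically, so that a maximal size can be chosen; the empty set is
    independent, and sizes are bounded by [n]. *)
Lemma qrank_exists m n (A : 'M[H]_(m, n)) : exists k, qrank A k.
Proof.
pose P k := `[< exists2 S : {set 'I_n}, #|S| = k & cols_indep A S >].
have P0 : exists k, P k.
  exists 0; apply/asboolP; exists set0; first exact: cards0.
  by move=> v v0 _; apply/colP => i; rewrite v0 ?mxE // inE.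
have Pb k : P k -> (k <= n)%N.
  by case/asboolP => S <- _; rewrite -[X in (_ <= X)%N]card_ord max_card.
case: (ex_maxnP P0 Pb) => k /asboolP Pk kmax; exists k; split => // S SA.
by apply: kmax; apply/asboolP; exists S.
Qed.

Lemma is_MP_adj m n (A : 'M[H]_(m, n)) X : is_MP A X -> is_MP (qadj A) (qadj X).
Proof.
case=> AXA XAX AXh XAh; split; rewrite -!qadjM ?mulmxA ?AXA ?XAX //.
- by rewrite XAh.
- by rewrite AXh.
Qed.

(** By [qrank_trace] the two ranks are the real traces of [X *m A] and of
    [qadj X *m qadj A = A *m X], which agree by cyclicity. *)
Lemma qrank_adj m n (A : 'M[H]_(m, n)) X k : is_MP A X -> qrank A k -> qrank (qadj A) k.
Proof.
move=> AX Ak; have [k' A'k] := qrank_exists (qadj A).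
suff -> : k = k' by [].
apply/eqP; rewrite -(eqr_nat R) -(qrank_trace Ak AX) -(qrank_trace A'k (is_MP_adj AX)).
apply/eqP; case: AX => _ _ AXh _; rewrite -qadjM AXh.
under eq_bigr => i _ do rewrite mxE qc_sum.
under [RHS]eq_bigr => i _ do rewrite mxE qc_sum.
by rewrite exchange_big /=; apply: eq_bigr => i _; apply: eq_bigr => j _; apply: qc0_mulC.
Qed.

End RankAdjoint.

(** * Determinantal representations *)

Section DeterminantalRepresentation.
Variable R : realType.
Local Notation H := (quat R).

Lemma sum_cdet_pr n (F : 'M[H]_n) k g (c : 'cV[H]_n) :
  \sum_(b : {set 'I_n} | (#|b| == k) && (g \in b)) cdet_pr (col_repl g c F) b g =
  (padjs F k *m c) g 0.
Proof.
rewrite /padjs mulmx_suml summxE [RHS](bigID (fun b : {set 'I_n} => g \in b)) /=.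
rewrite [X in _ = _ + X]big1 ?addr0 => [|b /andP[_ gb]].
  by apply: eq_bigr => b /andP[_ gb]; apply: cdet_pr_repl.
by rewrite mxE big1 // => l _; rewrite padj_outl // mul0r.
Qed.

Lemma sum_hdet_pr n (F : 'M[H]_n) k : qadj F = F ->
  \sum_(b : {set 'I_n} | #|b| == k) hdet_pr F b = pdets F k.
Proof. by move=> Fh; apply: eq_bigr => b _; apply: hdet_prE (pdet_real Fh b). Qed.

Section LeftFactor.
Variables (m n : nat) (A : 'M[H]_(m, n)) (X : 'M[H]_(n, m)) (k : nat).
Hypotheses (Ak : qrank A k) (AX : is_MP A X).

(** The representation before division; it evaluates both numerators in the product term of the
    theorem. *)
Lemma padjs_MP_mul q (C : 'M[H]_(m, q)) g f :
  (padjs (qadj A *m A) k *m col f (qadj A *m C)) g 0 = pdets (qadj A *m A) k * (X *m C) g f.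
Proof.
have -> : padjs (qadj A *m A) k *m col f (qadj A *m C) =
    padjs (qadj A *m A) k *m qadj A *m col f C by rewrite !colE !mulmxA.
rewrite mxE [in RHS]mxE mulr_sumr; apply: eq_bigr => l _.
by rewrite (padjs_MP Ak AX) mulrA [col f C l 0]mxE.
Qed.

Lemma MP_mul_cdet q (C : 'M[H]_(m, q)) g f :
  (X *m C) g f =
  qdiv (\sum_(b : {set 'I_n} | (#|b| == k) && (g \in b))
          cdet_pr (col_repl g (col f (qadj A *m C)) (qadj A *m A)) b g)
       (\sum_(b : {set 'I_n} | #|b| == k) hdet_pr (qadj A *m A) b).
Proof.
rewrite sum_cdet_pr sum_hdet_pr ?gram_herm //.
apply: qdiv_real; rewrite ?pdets_real ?gram_herm ?pdets_neq0 //.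
by rewrite padjs_MP_mul.
Qed.

End LeftFactor.

(** [C *m X] is the adjoint of [qadj X *m qadj C], to which [MP_mul_cdet] applies since [qadj B]
    also has rank [k]. Conjugation turns column into row determinants and fixes the real
    denominator. *)
Lemma mul_MP_rdet m n q (B : 'M[H]_(m, n)) X k (C : 'M[H]_(q, n)) i j :
  qrank B k -> is_MP B X ->
  (C *m X) i j =
  qdiv (\sum_(a : {set 'I_m} | (#|a| == k) && (j \in a))
          rdet_pr (row_repl j (row i (C *m qadj B)) (B *m qadj B)) a j)
       (\sum_(a : {set 'I_m} | #|a| == k) hdet_pr (B *m qadj B) a).
Proof.
move=> Bk BX; have B'k := qrank_adj BX Bk; have B'X := is_MP_adj BX.
have BBh : qadj (B *m qadj B) = B *m qadj B by rewrite qadjM qadjK.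
have := MP_mul_cdet B'k B'X (qadj C) j i; rewrite qadjK => E.
have -> : (C *m X) i j = qconj ((qadj X *m qadj C) j i) by rewrite -qadjM qadjE qconjK.
have dn0 : pdets (B *m qadj B) k != 0 by have := pdets_neq0 B'k; rewrite qadjK.
rewrite E !sum_hdet_pr // qconj_div ?pdets_real //; congr (qdiv _ _).
rewrite qconj_sum; apply: eq_bigr => a /andP[_ ja]; rewrite rdet_pr_conj //.
congr (qconj (cdet_pr _ _ _)); apply/matrixP => x y.
rewrite qadjE [in LHS]mxE [in RHS]mxE.
case: ifP => _; last by rewrite -{1}BBh qadjE.
by rewrite [in LHS]mxE [in RHS]mxE -qadjE qadjM qadjK.
Qed.

End DeterminantalRepresentation.

Theorem theorem5p4 (R : realType) (r s m p r1 r2 : nat)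
  (B1 : 'M[quat R]_(r, s)) (A2 : 'M[quat R]_(m, p)) (C : 'M[quat R]_(m, s))
  (B1d : 'M[quat R]_(s, r)) (A2d : 'M[quat R]_(p, m)) :
  qrank B1 r1 -> qrank A2 r2 ->
  is_MP B1 B1d -> is_MP A2 A2d ->
  let X1 := C *m B1d in
  let X2 := A2d *m C - A2d *m C *m (B1d *m B1) in
  let C1 := C *m qadj B1 in
  let C2 := qadj A2 *m C in
  let BBs := B1 *m qadj B1 in
  let BsB := qadj B1 *m B1 in
  let AsA := qadj A2 *m A2 in
  (forall (i : 'I_m) (j : 'I_r),
     X1 i j =
     qdiv (\sum_(a : {set 'I_r} | (#|a| == r1) && (j \in a))
             rdet_pr (row_repl j (row i C1) BBs) a j)
          (\sum_(a : {set 'I_r} | #|a| == r1) hdet_pr BBs a)) /\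
  (forall (g : 'I_p) (f : 'I_s),
     X2 g f =
     qdiv (\sum_(b : {set 'I_p} | (#|b| == r2) && (g \in b))
             cdet_pr (col_repl g (col f C2) AsA) b g)
          (\sum_(b : {set 'I_p} | #|b| == r2) hdet_pr AsA b)
     - qdiv (\sum_(l < s)
               (\sum_(b : {set 'I_p} | (#|b| == r2) && (g \in b))
                   cdet_pr (col_repl g (col l C2) AsA) b g) *
               (\sum_(b : {set 'I_s} | (#|b| == r1) && (l \in b))
                   cdet_pr (col_repl l (col f BsB) BsB) b l))
            ((\sum_(b : {set 'I_p} | #|b| == r2) hdet_pr AsA b) *
             (\sum_(b : {set 'I_s} | #|b| == r1) hdet_pr BsB b))).
Proof.
move=> B1r A2r B1X A2X X1 X2 C1 C2 BBs BsB AsA; split=> [i j | g f].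
  exact: mul_MP_rdet.
have AsAh : qadj AsA = AsA by apply: gram_herm.
have BsBh : qadj BsB = BsB by apply: gram_herm.
have dA := pdets_neq0 A2r; have dB := pdets_neq0 B1r.
rewrite -(MP_mul_cdet A2r A2X) /X2 !mxE; congr (_ - _).
(* Both factors of the denominator are real and nonzero, so the fraction can be cleared. *)
rewrite !sum_hdet_pr //; apply: qdiv_real.
- by rewrite qmul_realM ?pdets_real.
- apply: contra dB => /eqP E; apply/eqP; apply: contraTeq isT => dB.
  by case/eqP: dA; apply: qreal_mul_eq0 E dB; rewrite pdets_real.
rewrite mulr_sumr; apply: eq_bigr => l _.
(* The second factor is [padjs_MP_mul] with right-hand side [B1] itself, which produces the entries
   of the projector [B1d *m B1]. *)
rewrite !sum_cdet_pr (padjs_MP_mul A2r A2X) (padjs_MP_mul B1r B1X).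
rewrite -!mulrA; congr (_ * _); rewrite !mulrA; congr (_ * _).
by rewrite qreal_central ?pdets_real.
Qed.
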